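(* Let $\Gamma$ be a planning context, let $F_1, F_2$ be PDDL formulae, and let $f$ be a plan such that $\Gamma \vdash \{F_1\!\downarrow_{+}\} \leadsto \{F_2\!\downarrow_{+}\} \mid f$ is derivable by the rules of the PCP logic. Then for every world $w$ such that $w \models_{+} F_1$, and every action handler $\delta$ that is well-formed (with respect to $\Gamma$), we have $[\![f]\!]^{\delta}\, w \models_{+} F_2$.
   Context: **Syntax.** Fix a set of predicate symbols $R$ with arities, a set $X$ of variables, a set $C$ of constants, and a set of action names $\alpha$ (with arities). A term is a variable or a constant. An atom is $A ::= R(t_1,\dots,t_n)$ with $t_i$ terms. A constraint is $t = t'$ or $t \neq t'$ with $t,t'$ terms; a constraint list $\phi$ is a finite list of constraints. An action is an action name applied to terms, $a ::= \alpha(t_1,\dots,t_n)$. Plans are given by $f ::= \mathit{shrink} \mid a \mid f;f_1$ (the actions in plans are ground). Polarities are $z \in \{+,-\}$, with $-(+) = -$ and $-(-)=+$. A state is a finite list of formula maps: $P ::= \mathit{emp} \mid A\mapsto z \mid P*Q$, where $*$ is list concatenation with unit $\mathit{emp}$. Write $A \mapsto z\in P$ for list membership, and $A\notin P$ if neither $A\mapsto +$ nor $A\mapsto -$ is in $P$. $\mathit{emp}$ is valid, and $A\mapsto z * P$ is valid iff $A \notin P$ and $P$ is valid. ''Ground'' means containing no variables. $[\sigma]$ denotes application of a ground substitution $\sigma$ (a map from variables to constants, defined on all variables concerned). **Context.** A planning context $\Gamma$ is a set of action descriptions $\phi(\overline x);\{P(\overline x)\}\leadsto\{Q(\overline x)\}\mid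 \alpha(\overline x)$, where $\overline x$ is a list of distinct variables, all variables of $\phi,P,Q$ are among $\overline x$, and each action name $\alpha$ has at most one description in $\Gamma$. **Constraint normalisation.** $\mathit{norm}\,[]=\top$; $\mathit{norm}(t=t_1::\phi)$ is $\mathit{norm}\,\phi$ if $t,t_1$ are syntactically equal and $\bot$ otherwise; $\mathit{norm}(t\ne t_1::\phi)$ is $\bot$ if $t,t_1$ are syntactically equal and $\mathit{norm}\,\phi$ otherwise. ''$\phi$ normalises to $\top$'' means $\mathit{norm}\,\phi=\top$. **Subtyping** $<:$ on states is inductively defined by: $S <: \mathit{emp}$; and if $S' <: S$ and $A\mapsto z\in S'$ then $S' <: A\mapsto z * S$. **Override.** $P\sqcup \mathit{emp}=P$; $P\sqcup(A\mapsto z * Q) = (A\mapsto z * (P\setminus\{A\mapsto +, A\mapsto -\}))\sqcup Q$, where $P\setminus\{\dots\}$ removes all occurrences of the listed maps. **Rules of the PCP logic** (deriving $\Gamma\vdash\{P\}\leadsto\{Q\}\mid f$ with $P,Q$ ground; all states occurring in rules must be valid): - ApplyAction: if $\phi(\overline x);\{P(\overline x)\}\leadsto\{Q(\overline x)\}\mid\alpha(\overline x)\in\Gamma$, $\sigma$ is a ground substitution and $\phi(\overline x)[\sigma]$ normalises to $\top$, then $\Gamma\vdash\{P(\overline x)[\sigma]\}\leadsto\{Q(\overline x)[\sigma]\}\mid\alpha(\overline x)[\sigma]$. - Frame: if $\Gamma\vdash\{P\}\leadsto\{Q\}\mid a$ with $a$ a single action, and $A\notin P$, $A\notin Q$, then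 $\Gamma\vdash\{P*A\mapsto z\}\leadsto\{Q*A\mapsto z\}\mid a$. - Weakening: if $P'<:P$ and $\Gamma\vdash\{P\}\leadsto\{Q\}\mid f$ then $\Gamma\vdash\{P'\}\leadsto\{Q\}\mid f$. - Shrink: if $Q<:Q'$ and $\Gamma\vdash\{P\}\leadsto\{Q\}\mid f$ then $\Gamma\vdash\{P\}\leadsto\{Q'\}\mid f;\mathit{shrink}$. - Composition: if $Q<:Q'$, $\Gamma\vdash\{P\}\leadsto\{Q\}\mid f$ and $\Gamma\vdash\{Q'\}\leadsto\{R\}\mid f_1$ then $\Gamma\vdash\{P\}\leadsto\{R\}\mid f;f_1$. **Worlds.** A world $w$ is a set of ground atoms. For a ground state $S$, $\langle w_S\rangle$ is the set of worlds $w$ (well-formed worlds for $S$) that contain every $A$ with $A\mapsto +\in S$ and contain no $A$ with $A\mapsto -\in S$. **Action handlers and evaluation.** An action handler $\delta$ is a function taking a ground action and a world to a world. Evaluation of plans: $[\![\mathit{shrink}]\!]^\delta w = w$; $[\![a]\!]^\delta w=\delta\,a\,w$; $[\![f;f_1]\!]^\delta w=[\![f_1]\!]^\delta([\![f]\!]^\delta w)$. $\delta$ is well-formed (with respect to $\Gamma$) if for every $\phi(\overline x);\{P'(\overline x)\}\leadsto\{Q(\overline x)\}\mid\alpha(\overline x)\in\Gamma$, every ground substitution $\sigma$ such that $\phi(\overline x)[\sigma]$ normalises to $\top$, every ground state $P$ with $P<:P'(\overline x)[\sigma]$ (all states $P$, $P'(\overline x)[\sigma]$, $Q(\overline x)[\sigma]$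 being valid), and every $w\in\langle w_P\rangle$, we have $\delta\,(\alpha(\overline x)[\sigma])\,w\in\langle w_{P\sqcup Q(\overline x)[\sigma]}\rangle$. **PDDL formulae.** $F ::= A^g\mid\neg A^g\mid F\wedge F_1$, where $A^g$ ranges over ground atoms. Satisfaction $w\models_z F$ is inductively defined by: $w\models_+A^g$ if $A^g\in w$; $w\models_-A^g$ if $A^g\notin w$; $w\models_z\neg A^g$ if $w\models_{-z}A^g$; $w\models_z F\wedge F_1$ if $w\models_zF$ and $w\models_zF_1$. **Normalisation of formulae to states.** $(F\wedge F_1)\!\downarrow_z S=F_1\!\downarrow_z(F\!\downarrow_z S)$; $(\neg A^g)\!\downarrow_z S=A^g\!\downarrow_{-z}S$; $A^g\!\downarrow_zS=A^g\mapsto z * S$; and $F\!\downarrow_z$ abbreviates $F\!\downarrow_z\mathit{emp}$. *)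

(* Defs.v *)
From HB Require Import structures.
From mathcomp Require Import all_boot.
From mathcomp Require Import classical_sets.

Set Implicit Arguments.
Unset Strict Implicit.
Unset Printing Implicit Defensive.

Local Open Scope classical_set_scope.

Record signature := Signature {
  pred_sym : eqType;
  pred_arity : pred_sym -> nat;
  var_sym : eqType;
  cst_sym : eqType;
  act_sym : eqType;
  act_arity : act_sym -> nat
}.

Inductive term (Sg : signature) : Type :=
  | Var of var_sym Sg
  | Cst of cst_sym Sg.
Arguments Var {Sg} _.
Arguments Cst {Sg} _.

Definition term_to_sum (Sg : signature) (t : term Sg) :
    var_sym Sg + cst_sym Sg :=
  match t with Var x => inl x | Cst c => inr c end.

Definition term_of_sum (Sg : signature) (u : var_sym Sg + cst_sym Sg) :
    term Sg :=
  match u with inl x => Var x | inr c => Cst c end.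

Lemma term_to_sumK (Sg : signature) :
  cancel (@term_to_sum Sg) (@term_of_sum Sg).
Proof. by case. Qed.

HB.instance Definition _ (Sg : signature) :=
  Equality.copy (term Sg) (can_type (@term_to_sumK Sg)).

(* A symbol applied to as many terms as its arity; used for both atoms and
   actions. *)
Definition applied (Sg : signature) (I : eqType) (ar : I -> nat) : eqType :=
  {s : I & (ar s).-tuple (term Sg)}.

Definition atom (Sg : signature) : eqType := applied Sg (@pred_arity Sg).
Definition action (Sg : signature) : eqType := applied Sg (@act_arity Sg).

(* The polarities + and - are the booleans true and false, so that -z is ~~ z. *)
Notation polarity := bool.

Inductive constraint (Sg : signature) : Type :=
  | CEq of term Sg & term Sg
  | CNeq of term Sg & term Sg.

(* The pair (A, z) stands for A |-> z. *)
Definition state (Sg : signature) : Type := seq (atom Sg * polarity).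

Definition term_vars (Sg : signature) (t : term Sg) : seq (var_sym Sg) :=
  match t with Var x => [:: x] | Cst _ => [::] end.

Definition applied_vars (Sg : signature) (I : eqType) (ar : I -> nat)
    (a : applied Sg ar) : seq (var_sym Sg) :=
  flatten [seq term_vars t | t <- tagged a].

Definition constraint_vars (Sg : signature) (c : constraint Sg) :
    seq (var_sym Sg) :=
  match c with CEq t u | CNeq t u => term_vars t ++ term_vars u end.

Definition constraints_vars (Sg : signature) (phi : seq (constraint Sg)) :
    seq (var_sym Sg) :=
  flatten [seq constraint_vars c | c <- phi].

Definition state_vars (Sg : signature) (P : state Sg) : seq (var_sym Sg) :=
  flatten [seq applied_vars m.1 | m <- P].

Definition ground (Sg : signature) (I : eqType) (ar : I -> nat) :
    pred (applied Sg ar) :=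
  fun a => nilp (applied_vars a).

Definition ground_state (Sg : signature) (P : state Sg) : bool :=
  nilp (state_vars P).

Definition ground_atom (Sg : signature) : eqType := {A : atom Sg | ground A}.
Definition ground_action (Sg : signature) : eqType :=
  {a : action Sg | ground a}.

(* Ground substitutions are partial, so that they exist (for parameterless
   actions) even when there are no constants. *)
Definition substitution (Sg : signature) : Type :=
  var_sym Sg -> option (cst_sym Sg).

Definition defined_on (Sg : signature) (sigma : substitution Sg)
    (xs : seq (var_sym Sg)) : bool :=
  all (fun x => isSome (sigma x)) xs.

Definition subst_term (Sg : signature) (sigma : substitution Sg)
    (t : term Sg) : term Sg :=
  match t with
  | Var x => if sigma x is Some c then Cst c else Var x
  | Cst c => Cst c
  end.

Definition subst (Sg : signature) (sigma : substitution Sg)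
    (I : eqType) (ar : I -> nat) (a : applied Sg ar) : applied Sg ar :=
  Tagged (fun s => (ar s).-tuple (term Sg))
    (map_tuple (subst_term sigma) (tagged a)).

Definition subst_constraint (Sg : signature) (sigma : substitution Sg)
    (c : constraint Sg) : constraint Sg :=
  match c with
  | CEq t u => CEq (subst_term sigma t) (subst_term sigma u)
  | CNeq t u => CNeq (subst_term sigma t) (subst_term sigma u)
  end.

Definition subst_constraints (Sg : signature) (sigma : substitution Sg)
    (phi : seq (constraint Sg)) : seq (constraint Sg) :=
  [seq subst_constraint sigma c | c <- phi].

Definition subst_state (Sg : signature) (sigma : substitution Sg)
    (P : state Sg) : state Sg :=
  [seq (subst sigma m.1, m.2) | m <- P].

(* The result true is top, false is bottom. *)
Fixpoint norm (Sg : signature) (phi : seq (constraint Sg)) : bool :=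
  match phi with
  | [::] => true
  | CEq t u :: phi' => if t == u then norm phi' else false
  | CNeq t u :: phi' => if t == u then false else norm phi'
  end.

Definition fresh (Sg : signature) (A : atom Sg) (P : state Sg) : bool :=
  ((A, true) \notin P) && ((A, false) \notin P).

Fixpoint valid (Sg : signature) (P : state Sg) : bool :=
  match P with
  | [::] => true
  | (A, _) :: P' => fresh A P' && valid P'
  end.

Inductive subtype (Sg : signature) : state Sg -> state Sg -> Prop :=
  | subtype_emp (S : state Sg) : subtype S [::]
  | subtype_cons (S S' : state Sg) (A : atom Sg) (z : polarity) :
      subtype S' S -> (A, z) \in S' -> subtype S' ((A, z) :: S).

Fixpoint override (Sg : signature) (P Q : state Sg) : state Sg :=
  match Q with
  | [::] => P
  | (A, z) :: Q' =>
      override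
        ((A, z) :: [seq m <- P | m \notin [:: (A, true); (A, false)]]) Q'
  end.

Record description (Sg : signature) : Type := Description {
  d_name : act_sym Sg;
  d_params : (act_arity d_name).-tuple (var_sym Sg);
  d_constr : seq (constraint Sg);
  d_pre : state Sg;
  d_post : state Sg
}.

Definition d_action (Sg : signature) (d : description Sg) : action Sg :=
  Tagged (fun s => (act_arity s).-tuple (term Sg))
    (map_tuple Var (d_params d)).

Definition wf_description (Sg : signature) (d : description Sg) : Prop :=
  [/\ uniq (d_params d),
      {subset constraints_vars (d_constr d) <= d_params d},
      {subset state_vars (d_pre d) <= d_params d}
    & {subset state_vars (d_post d) <= d_params d}].

Definition planning_context (Sg : signature) (Gamma : set (description Sg)) :
    Prop :=
  (forall d, Gamma d -> wf_description d) /\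
  (forall d d', Gamma d -> Gamma d' -> d_name d = d_name d' -> d = d').

Inductive plan (Sg : signature) : Type :=
  | Shrink
  | Act of ground_action Sg
  | Seq of plan Sg & plan Sg.
Arguments Shrink {Sg}.

Definition ground_valid (Sg : signature) (P : state Sg) : Prop :=
  ground_state P /\ valid P.

Inductive derivable (Sg : signature) (Gamma : set (description Sg)) :
    state Sg -> state Sg -> plan Sg -> Prop :=
  | ApplyAction (d : description Sg) (sigma : substitution Sg)
      (a : ground_action Sg) :
      Gamma d ->
      defined_on sigma (d_params d) ->
      norm (subst_constraints sigma (d_constr d)) ->
      val a = subst sigma (d_action d) ->
      ground_valid (subst_state sigma (d_pre d)) ->
      ground_valid (subst_state sigma (d_post d)) ->
      derivable Gamma (subst_state sigma (d_pre d))
        (subst_state sigma (d_post d)) (Act a)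
  | Frame (P Q : state Sg) (a : ground_action Sg) (A : atom Sg)
      (z : polarity) :
      ground_valid P -> ground_valid Q ->
      ground_valid (P ++ [:: (A, z)]) -> ground_valid (Q ++ [:: (A, z)]) ->
      fresh A P -> fresh A Q ->
      derivable Gamma P Q (Act a) ->
      derivable Gamma (P ++ [:: (A, z)]) (Q ++ [:: (A, z)]) (Act a)
  | Weakening (P P' Q : state Sg) (f : plan Sg) :
      ground_valid P -> ground_valid P' -> ground_valid Q ->
      subtype P' P ->
      derivable Gamma P Q f ->
      derivable Gamma P' Q f
  | ShrinkRule (P Q Q' : state Sg) (f : plan Sg) :
      ground_valid P -> ground_valid Q -> ground_valid Q' ->
      subtype Q Q' ->
      derivable Gamma P Q f ->
      derivable Gamma P Q' (Seq f Shrink)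
  | Composition (P Q Q' R : state Sg) (f f1 : plan Sg) :
      ground_valid P -> ground_valid Q -> ground_valid Q' -> ground_valid R ->
      subtype Q Q' ->
      derivable Gamma P Q f ->
      derivable Gamma Q' R f1 ->
      derivable Gamma P R (Seq f f1).

Definition world (Sg : signature) : Type := set (ground_atom Sg).

Definition wf_worlds (Sg : signature) (S : state Sg) : set (world Sg) :=
  [set w : world Sg | forall A : ground_atom Sg,
     ((val A, true) \in S -> w A) /\ ((val A, false) \in S -> ~ w A)].

Definition handler (Sg : signature) : Type :=
  ground_action Sg -> world Sg -> world Sg.

Fixpoint eval (Sg : signature) (delta : handler Sg) (f : plan Sg)
    (w : world Sg) : world Sg :=
  match f with
  | Shrink => w
  | Act a => delta a w
  | Seq f1 f2 => eval delta f2 (eval delta f1 w)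
  end.

Definition wf_handler (Sg : signature) (Gamma : set (description Sg))
    (delta : handler Sg) : Prop :=
  forall (d : description Sg) (sigma : substitution Sg)
    (a : ground_action Sg) (P : state Sg) (w : world Sg),
    Gamma d ->
    defined_on sigma (d_params d) ->
    norm (subst_constraints sigma (d_constr d)) ->
    val a = subst sigma (d_action d) ->
    ground_valid P ->
    ground_valid (subst_state sigma (d_pre d)) ->
    ground_valid (subst_state sigma (d_post d)) ->
    subtype P (subst_state sigma (d_pre d)) ->
    wf_worlds P w ->
    wf_worlds (override P (subst_state sigma (d_post d))) (delta a w).

Inductive formula (Sg : signature) : Type :=
  | FAtom of ground_atom Sg
  | FNeg of ground_atom Sg
  | FAnd of formula Sg & formula Sg.

Inductive sat (Sg : signature) (w : world Sg) :
    polarity -> formula Sg -> Prop :=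
  | sat_pos (A : ground_atom Sg) : w A -> sat w true (FAtom A)
  | sat_neg (A : ground_atom Sg) : ~ w A -> sat w false (FAtom A)
  | sat_not (z : polarity) (A : ground_atom Sg) :
      sat w (~~ z) (FAtom A) -> sat w z (FNeg A)
  | sat_and (z : polarity) (F F1 : formula Sg) :
      sat w z F -> sat w z F1 -> sat w z (FAnd F F1).

Fixpoint normalise (Sg : signature) (F : formula Sg) (z : polarity)
    (S : state Sg) : state Sg :=
  match F with
  | FAtom A => (val A, z) :: S
  | FNeg A => (val A, ~~ z) :: S
  | FAnd F1 F2 => normalise F2 z (normalise F1 z S)
  end.

(* Main.v *)
(* By induction on the derivation, a derivable triple for a single action has
   the same guarantee as a description: from any valid state below the
   precondition, the action leads to the override of that whole state by the
   postcondition. Keeping the whole state is what makes the Frame rule go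
   through. Overriding by Q entails Q, so every plan maps the worlds of its
   precondition to worlds of its postcondition, and the worlds of a normalised
   formula are exactly its models. *)
Require Import Defs.
From mathcomp Require Import all_boot.
From mathcomp Require Import classical_sets.

(** As an inclusion, subtyping is visibly transitive and acts directly on membership. *)
Lemma subtypeP {Sg : signature} {S' S : state Sg} :
  subtype S' S <-> {subset S <= S'}.
Proof.
split=> [|sub].
  by elim=> // {S'}S S' A z _ IH Az m; rewrite inE => /predU1P[->|/IH].
elim: S sub => [|[A z] S IH] sub; first exact: subtype_emp.
apply: subtype_cons; last by apply: sub; rewrite mem_head.
by apply: IH => m mS; apply: sub; rewrite inE mS orbT.
Qed.

Lemma fresh_cons {Sg : signature} (A B : atom Sg) (z : polarity)
    (P : state Sg) :
  fresh A ((B, z) :: P) = (A != B) && fresh A P.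
Proof.
by rewrite /fresh !inE !xpair_eqE; case: (A == B); case: z => //=;
  rewrite andbF.
Qed.

(** A map put in by [Q] could only be erased by a later entry of [Q] for the same atom, which
    validity excludes. *)
Lemma mem_override {Sg : signature} (m : atom Sg * polarity)
    (P Q : state Sg) : valid Q ->
  (m \in override P Q) = (m \in Q) || (m \in P) && fresh m.1 Q.
Proof.
elim: Q P => [|[A z] Q IH] P /=; first by rewrite andbT.
case/andP=> frA vQ; rewrite {}IH // fresh_cons.
have mA : (m \in [:: (A, true); (A, false)]) = (m.1 == A).
  by case: m => B [] /=; rewrite !inE !xpair_eqE /= ?andbT ?andbF ?orbF.
rewrite !inE mem_filter -[m \notin _]/(~~ (m \in _)) mA.
have [->|_] := eqVneq m (A, z); first by rewrite /= frA !orbT.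
by rewrite /=; case: (m \in Q) => //=; rewrite andbCA andbA.
Qed.

Lemma wf_worlds_sub {Sg : signature} {S S' : state Sg} {w : world Sg} :
  {subset S' <= S} -> wf_worlds S w -> wf_worlds S' w.
Proof. by move=> sub wS A; split=> /sub; case: (wS A). Qed.

(** Each rule has these facts among its premises, so a case analysis suffices. *)
Lemma derivable_ground_valid {Sg : signature} {Gamma : set (description Sg)}
    {P Q : state Sg} {f : plan Sg} :
  derivable Gamma P Q f -> ground_valid P /\ ground_valid Q.
Proof. by case. Qed.

Lemma derivable_act_override {Sg : signature}
    {Gamma : set (description Sg)} {delta : handler Sg}
    {P Q : state Sg} {a : ground_action Sg} :
  wf_handler Gamma delta -> derivable Gamma P Q (Act a) ->
  forall (S : state Sg) (w : world Sg),
    ground_valid S -> {subset P <= S} -> wf_worlds S w ->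
    wf_worlds (override S Q) (delta a w).
Proof.
move=> wfd; move Ef: (Act a) => f der.
elim: der Ef => {P Q f}.
- move=> d sigma b Gd def nrm vb gP gQ [->] S w gS sub wS.
  by apply: wfd wS => //; apply/subtypeP.
- move=> P Q b A z _ [_ vQ] _ [_ vQA] _ frA _ IH Ef S w gS sub wS.
  have subPS : {subset P <= S}.
    by move=> m mP; apply: sub; rewrite mem_cat mP.
  (* It suffices that [override S Q] contains all maps of the override by the framed postcondition.
     The framed map [(A, z)] lies in [S] by inclusion of the framed precondition, and it survives
     because [A] is fresh in [Q]. *)
  apply: wf_worlds_sub (IH Ef S w gS subPS wS) => m.
  rewrite !mem_override // mem_cat inE /fresh !mem_cat !negb_or.
  case: (m \in Q) => //=.
  case/orP=> [/eqP->|/andP[-> /andP[/andP[-> _] /andP[-> _]]] //].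
  by rewrite sub ?mem_cat ?inE ?eqxx ?orbT.
- move=> P P' Q f _ _ _ /subtypeP subP _ IH Ef S w gS sub wS.
  by apply: IH wS => // m /subP/sub.
- by [].
- by [].
Qed.

Lemma derivable_sound {Sg : signature} {Gamma : set (description Sg)}
    {delta : handler Sg} {P Q : state Sg} {f : plan Sg} :
  wf_handler Gamma delta -> derivable Gamma P Q f ->
  forall w : world Sg, wf_worlds P w -> wf_worlds Q (eval delta f w).
Proof.
move=> wfd.
have sound_act P' Q' a w : derivable Gamma P' Q' (Act a) ->
    wf_worlds P' w -> wf_worlds Q' (delta a w).
  move=> der wP; have [gP [_ vQ]] := derivable_ground_valid der.
  have := derivable_act_override wfd der P' w gP (fun _ => id) wP.
  by apply: wf_worlds_sub => m mQ; rewrite mem_override // mQ.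
elim=> {P Q f}.
(* Both single-action rules go through [sound_act]: for Frame, the induction hypothesis would say
   nothing about the framed atom. *)
- by move=> *; apply: sound_act => //; apply: ApplyAction.
- by move=> *; apply: sound_act => //; apply: Frame.
- move=> P P' Q f _ _ _ /subtypeP sub _ IH w wP'.
  exact/IH/(wf_worlds_sub sub).
- move=> P Q Q' f _ _ _ /subtypeP sub _ IH w wP /=.
  exact/(wf_worlds_sub sub)/IH.
- move=> P Q Q' R f f1 _ _ _ _ /subtypeP sub _ IHf _ IHf1 w wP /=.
  exact/IHf1/(wf_worlds_sub sub)/IHf.
Qed.

Lemma wf_worlds_cons {Sg : signature} (A : ground_atom Sg) (z : polarity)
    (S : state Sg) (w : world Sg) :
  wf_worlds ((val A, z) :: S) w <-> sat w z (FAtom A) /\ wf_worlds S w.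
Proof.
split=> [wAS|[satA wS] B].
  split; last by apply: wf_worlds_sub wAS => m mS; rewrite inE mS orbT.
  have [] := wAS A; case: z {wAS} => wA nwA.
    by apply: sat_pos; apply: wA; rewrite mem_head.
  by apply: sat_neg; apply: nwA; rewrite mem_head.
have [wB nwB] := wS B.
split; rewrite inE => /predU1P[[/val_inj eqBA eqz]|]; [|exact: wB| |exact: nwB];
  by rewrite eqBA; move: satA; rewrite -eqz => satA; inversion satA.
Qed.

Lemma sat_notE {Sg : signature} (w : world Sg) (z : polarity)
    (A : ground_atom Sg) : sat w z (FNeg A) <-> sat w (~~ z) (FAtom A).
Proof. by split=> [satA|]; [inversion satA | exact: sat_not]. Qed.

Lemma sat_andE {Sg : signature} (w : world Sg) (z : polarity)
    (F F1 : formula Sg) : sat w z (FAnd F F1) <-> sat w z F /\ sat w z F1.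
Proof. by split=> [satF|[]]; [inversion satF | exact: sat_and]. Qed.

(** The accumulator [S] is arbitrary because a conjunction normalises its second part on top of the
    first. The polarity can stay fixed in the induction, since negation applies only to atoms. *)
Lemma wf_worlds_normalise {Sg : signature} (F : formula Sg) (z : polarity)
    (S : state Sg) (w : world Sg) :
  wf_worlds (normalise F z S) w <-> sat w z F /\ wf_worlds S w.
Proof.
elim: F S => [A|A|F IH F1 IH1] S /=; first exact: wf_worlds_cons.
  by have := wf_worlds_cons A (~~ z) S w; have := sat_notE w z A; tauto.
have := IH1 (normalise F z S); have := IH S; have := sat_andE w z F F1; tauto.
Qed.

Theorem theorem12 (Sg : signature) (Gamma : set (description Sg))
    (F1 F2 : formula Sg) (f : plan Sg) :
  planning_context Gamma ->
  derivable Gamma (normalise F1 true [::]) (normalise F2 true [::]) f ->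
  forall (w : world Sg) (delta : handler Sg),
    sat w true F1 ->
    wf_handler Gamma delta ->
    sat (eval delta f w) true F2.
Proof.
move=> _ der w delta satF1 wfd.
have wF1 : wf_worlds (normalise F1 true [::]) w.
  by apply/wf_worlds_normalise; split.
by have /wf_worlds_normalise[] := derivable_sound wfd der w wF1.
Qed.
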